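(* Let $F$ be a field of characteristic $\ne2$. Let $P=\langle P_0\oplus P_1,\cdot,\{\,,\}\rangle$ be a unital Poisson superalgebra over $F$, and let $E:P\to P$ be a (parity-preserving) generalized derivation of $P$, i.e. a linear map with $$E(ab)=E(a)b+aE(b)-abE(1)\quad (a,b\in P),$$ which also satisfies $$E(\{p,q\})=\{E(p),q\}+\{p,E(q)\}+\{p,q\}E(1)\quad(p,q\in P).$$ Let $A$ be a (unital) commutative associative $F$-algebra with a derivation $D$. Then the bracket on $P\otimes A$ given, for homogeneous $p,q\in P$ and $a,b\in A$, by $$\langle p\otimes a,q\otimes b\rangle=\{p,q\}\otimes ab+E(p)q\otimes aD(b)-(-1)^{|p||q|}E(q)p\otimes D(a)b$$ is a Jordan bracket on the supercommutative associative superalgebra $P\otimes A=(P_0\otimes A)\oplus(P_1\otimes A)$.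
   Context: A dot-bracket superalgebra is an associative supercommutative superalgebra $(B=B_0+B_1,\cdot)$ with a super-skew-symmetric bilinear (even) product $\{\,,\}$, i.e. $\{f,g\}=-(-1)^{|f||g|}\{g,f\}$. For $B$ unital, the bracket is called a Jordan bracket if, with $\mathcal D(f)=\{f,1\}$, for all homogeneous $f,g,h\in B_0\cup B_1$ and $x\in B_1$: $$\{f,gh\}=\{f,g\}h+(-1)^{|f||g|}g\{f,h\}-\mathcal D(f)gh,$$ $$\{f,\{g,h\}\}-\{\{f,g\},h\}-(-1)^{|f||g|}\{g,\{f,h\}\}=\mathcal D(f)\{g,h\}+(-1)^{|g|(|f|+|h|)}\mathcal D(g)\{h,f\}+(-1)^{|h|(|f|+|g|)}\mathcal D(h)\{f,g\},$$ $$\{\{x,x\},x\}=-\{x,x\}\mathcal D(x).$$ A Poisson superalgebra is a dot-bracket superalgebra satisfying these identities with $\mathcal D\equiv0$. The product on $P\otimes A$ is $(p\otimes a)(q\otimes b)=pq\otimes ab$.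
   Formalization: In the second Jordan bracket identity the sign of the D(g){h,f} term is taken as (-1)^{|f|(|g|+|h|)} instead of the printed (-1)^{|g|(|f|+|h|)}, with which the claim fails, e.g. for P=F+Fξ, {ξ,ξ}=1, E(1)=1, E(ξ)=0, A=F[t], f=h=ξ⊗1, g=1⊗t. *)

(* Defs.v *)
From HB Require Import structures.
From mathcomp Require Import all_boot all_algebra.
From mathcomp Require Import boolp classical_sets.
Set Implicit Arguments.
Unset Strict Implicit.
Unset Printing Implicit Defensive.
Import GRing.Theory.
Local Open Scope ring_scope.
Local Open Scope quotient_scope.

Section LinearPredicates.
Variable F : fieldType.

Definition is_bilinear (U V W : lmodType F) (f : U -> V -> W) : Prop :=
  (forall v, linear (f ^~ v)) /\ (forall u, linear (f u)).

Definition is_subspace (V : lmodType F) (S : V -> Prop) : Prop :=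
  S 0 /\ (forall (c : F) u v, S u -> S v -> S (c *: u + v)).

Definition is_derivation (A : algType F) (D : A -> A) : Prop :=
  linear D /\ (forall a b, D (a * b) = D a * b + a * D b).

Section LinearFacts.
Variables (V W : lmodType F) (g : V -> W).
Hypothesis g_lin : linear g.

Lemma linD u v : g (u + v) = g u + g v.
Proof. by rewrite -[u in LHS]scale1r g_lin scale1r. Qed.

Lemma lin0 : g 0 = 0.
Proof. by apply: (addIr (g 0)); rewrite -linD !add0r. Qed.

Lemma linZ c u : g (c *: u) = c *: g u.
Proof. by rewrite -[c *: u]addr0 g_lin lin0 addr0. Qed.

Lemma lin_sum I (r : seq I) (h : I -> V) :
  g (\sum_(i <- r) h i) = \sum_(i <- r) g (h i).
Proof. exact: (big_morph g linD lin0). Qed.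

End LinearFacts.

End LinearPredicates.

(* The tensor product U (x) V over F: finite formal sums of pairs (u, v),     *)
(* encoded as lists, modulo the congruence generated by commutativity and the *)
(* bilinearity relations.                                                     *)
Section Tensor.
Variables (F : fieldType) (U V : lmodType F).

Inductive tensor_rel : seq (U * V) -> seq (U * V) -> Prop :=
| tensor_rel_refl s : tensor_rel s s
| tensor_rel_sym s t : tensor_rel s t -> tensor_rel t s
| tensor_rel_trans t s w : tensor_rel s t -> tensor_rel t w -> tensor_rel s w
| tensor_rel_cat s s' t t' :
    tensor_rel s s' -> tensor_rel t t' -> tensor_rel (s ++ t) (s' ++ t')
| tensor_rel_catC s t : tensor_rel (s ++ t) (t ++ s)
| tensor_rel_0 v : tensor_rel [:: (0, v)] [::]
| tensor_rel_Dl u u' v : tensor_rel [:: (u + u', v)] [:: (u, v); (u', v)]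
| tensor_rel_Dr u v v' : tensor_rel [:: (u, v + v')] [:: (u, v); (u, v')]
| tensor_rel_Z (c : F) u v : tensor_rel [:: (c *: u, v)] [:: (u, c *: v)].

Definition tensor_eq (s t : seq (U * V)) : bool := `[< tensor_rel s t >].

Lemma tensor_eq_refl : reflexive tensor_eq.
Proof. by move=> s; apply/asboolP; apply: tensor_rel_refl. Qed.

Lemma tensor_eq_sym : symmetric tensor_eq.
Proof.
by move=> s t; apply/asboolP/asboolP; apply: tensor_rel_sym.
Qed.

Lemma tensor_eq_trans : transitive tensor_eq.
Proof.
move=> t s w /asboolP st /asboolP tw; apply/asboolP.
exact: tensor_rel_trans st tw.
Qed.

Canonical tensor_equiv :=
  EquivRel tensor_eq tensor_eq_refl tensor_eq_sym tensor_eq_trans.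

Definition tensor := {eq_quot tensor_equiv}.

HB.instance Definition _ := Choice.on tensor.
HB.instance Definition _ := EqQuotient.on tensor.

Definition tens (u : U) (v : V) : tensor := \pi_tensor [:: (u, v)].

Definition tensor_add : tensor -> tensor -> tensor :=
  locked (fun x y => \pi_tensor (repr x ++ repr y)).

Definition tensor_scale : F -> tensor -> tensor :=
  locked (fun c x => \pi_tensor [seq (c *: z.1, z.2) | z <- repr x]).

Lemma tensor_piP s t : tensor_rel s t <-> \pi_tensor s = \pi_tensor t.
Proof.
split=> [st|/eqmodP/asboolP //].
by apply/eqmodP/asboolP.
Qed.

Lemma tensor_repr s : tensor_rel (repr (\pi_tensor s)) s.
Proof. by apply/tensor_piP; rewrite reprK. Qed.

Lemma tensor_add_pi s t :
  tensor_add (\pi_tensor s) (\pi_tensor t) = \pi_tensor (s ++ t).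
Proof.
rewrite /tensor_add -lock.
by apply/tensor_piP/tensor_rel_cat; apply: tensor_repr.
Qed.

Lemma tensor_rel_scale (c : F) s t : tensor_rel s t ->
  tensor_rel [seq (c *: z.1, z.2) | z <- s] [seq (c *: z.1, z.2) | z <- t].
Proof.
elim=> {s t} /=.
- by move=> s; apply: tensor_rel_refl.
- by move=> s t _; apply: tensor_rel_sym.
- by move=> t s w _ st _; apply: tensor_rel_trans.
- by move=> s s' t t' _ ss _ tt; rewrite !map_cat; apply: tensor_rel_cat.
- by move=> s t; rewrite !map_cat; apply: tensor_rel_catC.
- by move=> v; rewrite scaler0; apply: tensor_rel_0.
- by move=> u u' v; rewrite scalerDr; apply: tensor_rel_Dl.
- by move=> u v v'; apply: tensor_rel_Dr.
- move=> d u v; rewrite scalerA mulrC -scalerA; exact: tensor_rel_Z.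
Qed.

Lemma tensor_scale_pi c s :
  tensor_scale c (\pi_tensor s) = \pi_tensor [seq (c *: z.1, z.2) | z <- s].
Proof.
rewrite /tensor_scale -lock.
exact/tensor_piP/tensor_rel_scale/tensor_repr.
Qed.

Lemma tensor_addA : associative tensor_add.
Proof.
move=> x y z; elim/quotW: x => x; elim/quotW: y => y; elim/quotW: z => z.
by rewrite !tensor_add_pi catA.
Qed.

Lemma tensor_addC : commutative tensor_add.
Proof.
move=> x y; elim/quotW: x => x; elim/quotW: y => y.
by rewrite !tensor_add_pi; apply/tensor_piP/tensor_rel_catC.
Qed.

Lemma tensor_add0 : left_id (\pi_tensor [::]) tensor_add.
Proof. by move=> x; elim/quotW: x => x; rewrite tensor_add_pi. Qed.

Lemma tensor_rel_cons z s t : tensor_rel s t -> tensor_rel (z :: s) (z :: t).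
Proof. by move=> st; exact: (tensor_rel_cat (tensor_rel_refl [:: z]) st). Qed.

Lemma tensor_scaleDl x : {morph tensor_scale^~ x : a b / a + b >->
  tensor_add a b}.
Proof.
move=> a b; elim/quotW: x => s; rewrite !tensor_scale_pi tensor_add_pi.
apply/tensor_piP; elim: s => [|[u v] s IHs] /=; first exact: tensor_rel_refl.
rewrite scalerDl; set A := map (fun z => (a *: z.1, z.2)) s.
set B := map (fun z => (b *: z.1, z.2)) s.
apply: (tensor_rel_trans (tensor_rel_cat (tensor_rel_Dl _ _ _) IHs)) => /=.
apply: tensor_rel_cons; rewrite -/A -/B.
rewrite -cat_rcons -cats1.
exact: (tensor_rel_cat (tensor_rel_catC [:: _] A) (tensor_rel_refl B)).
Qed.

Lemma tensor_scale0 x : tensor_scale 0 x = \pi_tensor [::].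
Proof.
elim/quotW: x => s; rewrite tensor_scale_pi; apply/tensor_piP.
elim: s => [|[u v] s IHs] /=; first exact: tensor_rel_refl.
rewrite scale0r -cat1s -[[::]]cats0.
by apply: tensor_rel_cat => //; apply: tensor_rel_0.
Qed.

Lemma tensor_scale1 : left_id 1 tensor_scale.
Proof.
move=> x; elim/quotW: x => s; rewrite tensor_scale_pi; congr (\pi_tensor _).
by elim: s => [|[u v] s /= ->] //=; rewrite scale1r.
Qed.

Lemma tensor_addN : left_inverse (\pi_tensor [::]) (tensor_scale (-1)) tensor_add.
Proof.
by move=> x; rewrite -{2}[x]tensor_scale1 -tensor_scaleDl addNr tensor_scale0.
Qed.

HB.instance Definition _ := GRing.isZmodule.Build tensor
  tensor_addA tensor_addC tensor_add0 tensor_addN.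

Lemma tensor_scaleA a b x :
  tensor_scale a (tensor_scale b x) = tensor_scale (a * b) x.
Proof.
elim/quotW: x => s; rewrite !tensor_scale_pi -map_comp; congr (\pi_tensor _).
by apply: eq_map => z /=; rewrite scalerA.
Qed.

Lemma tensor_scaleDr : right_distributive tensor_scale +%R.
Proof.
move=> c x y; elim/quotW: x => s; elim/quotW: y => t.
rewrite [X in tensor_scale c X]tensor_add_pi !tensor_scale_pi.
by rewrite [RHS]tensor_add_pi map_cat.
Qed.

HB.instance Definition _ := GRing.Zmodule_isLmodule.Build F tensor
  tensor_scaleA tensor_scale1 tensor_scaleDr tensor_scaleDl.

Lemma tens_bilinear : is_bilinear tens.
Proof.
have Z c u v : tens (c *: u) v = c *: tens u v.
  by rewrite /tens [RHS]tensor_scale_pi.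
have Z' c u v : tens u (c *: v) = c *: tens u v.
  by rewrite -Z; apply/esym/tensor_piP/tensor_rel_Z.
split=> [v c u u'|u c v v'].
- rewrite -Z [RHS]tensor_add_pi; exact/tensor_piP/tensor_rel_Dl.
- rewrite -Z' [RHS]tensor_add_pi; exact/tensor_piP/tensor_rel_Dr.
Qed.

Lemma tensor_sum (x : tensor) : x = \sum_(z <- repr x) tens z.1 z.2.
Proof.
rewrite -{1}[x]reprK; elim: (repr x) => [|[u v] s IHs]; first by rewrite big_nil.
by rewrite big_cons -IHs [RHS]tensor_add_pi.
Qed.

(* The linear extension of a bilinear map; junk when f is not bilinear.       *)
Definition tensor_lift (W : lmodType F) (f : U -> V -> W) (x : tensor) : W :=
  \sum_(z <- repr x) f z.1 z.2.

Section UniversalProperty.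
Variables (W : lmodType F) (f : U -> V -> W).
Hypothesis f_bilin : is_bilinear f.

Lemma tensor_lift_pi s :
  tensor_lift f (\pi_tensor s) = \sum_(z <- s) f z.1 z.2.
Proof.
rewrite /tensor_lift; have := tensor_repr s; move: (repr _) => s'.
elim=> {s s'} //=.
- by move=> t t' w _ -> _ ->.
- by move=> t t' w w' _ IH _ IH'; rewrite !big_cat /= IH IH'.
- by move=> t w; rewrite !big_cat /= addrC.
- by move=> v; rewrite big_seq1 big_nil (lin0 (f_bilin.1 v)).
- by move=> u u' v; rewrite !big_cons !big_nil !addr0 (linD (f_bilin.1 v)).
- by move=> u v v'; rewrite !big_cons !big_nil !addr0 (linD (f_bilin.2 u)).
- move=> c u v; rewrite !big_seq1 /=.
  by rewrite (linZ (f_bilin.1 v)) (linZ (f_bilin.2 u)).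
Qed.

Lemma tensor_lift_linear : linear (tensor_lift f).
Proof.
move=> c x y; elim/quotW: x => s; elim/quotW: y => t.
rewrite [c *: _]tensor_scale_pi [X in tensor_lift f X]tensor_add_pi.
rewrite !tensor_lift_pi big_cat big_map scaler_sumr; congr (_ + _).
by apply: eq_bigr => z _; rewrite -(linZ (f_bilin.1 z.2)).
Qed.

Lemma tensor_lift_tens u v : tensor_lift f (tens u v) = f u v.
Proof. by rewrite tensor_lift_pi big_seq1. Qed.

End UniversalProperty.

Lemma tensor_ext (W : lmodType F) (g h : tensor -> W) :
  linear g -> linear h -> (forall u v, g (tens u v) = h (tens u v)) -> g =1 h.
Proof.
move=> lg lh gh x.
rewrite (tensor_sum x) (lin_sum lg) (lin_sum lh).
by apply: eq_bigr => z _; apply: gh.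
Qed.

End Tensor.

Notation "u ⊗ v" := (tens u v) (at level 40, left associativity) : ring_scope.

Section LinearForm.
Local Open Scope classical_set_scope.

(* Only needed for 1 != 0 in P (x) A, which algType F requires.               *)
Lemma linear_form_at1 (F : fieldType) (B : algType F) :
  exists2 phi : B -> F^o, linear phi & phi 1 = 1.
Proof.
pose Q (S : set B) := ~ S 1 /\ (S = set0 \/ is_subspace S).
have [|S [[nS1 S0] maxS]] := @Zorn_bigcup B Q.
- move=> C CQ Ctot; split=> [[X CX X1]|]; first by have [] := CQ _ CX.
  have [[X CX [x Xx]]|noX] := pselect (exists2 X, C X & exists x, X x); last first.
    left; apply/seteqP; split=> // x [X CX Xx].
    by case: noX; exists X => //; exists x.
  have sub Y y : C Y -> Y y -> is_subspace Y.
    by move=> CY Yy; have [_ [Y0|//]] := CQ _ CY; move: Yy; rewrite Y0.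
  right; split; first by exists X => //; have [] := sub _ _ CX Xx.
  move=> c u v [Y CY Yu] [Z CZ Zv].
  have [YZ|ZY] := Ctot _ _ CY CZ.
    by exists Z => //; apply: (sub _ _ CZ Zv).2 => //; apply: YZ.
  by exists Y => //; apply: (sub _ _ CY Yu).2 => //; apply: ZY.
have subS : is_subspace S.
  case: S0 => // S0; exfalso; apply: (maxS [set 0]).
    by rewrite S0; split=> // /(_ 0 erefl).
  split=> [/= /eqP|]; first by rewrite oner_eq0.
  by right; split=> //= c u v -> ->; rewrite scaler0 addr0.
have S1 c : S (c *: 1) -> c = 0.
  move=> Sc; apply/eqP/negPn/negP => c0; apply: nS1.
  have := subS.2 c^-1 _ _ Sc subS.1.
  by rewrite addr0 scalerA mulVf // scale1r.
have ex x : exists c : F, S (x - c *: 1).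
  apply: contrapT => nex.
  pose S' := [set y | exists c z, S z /\ y = c *: x + z]%classic.
  apply: (maxS S').
    split; first by move=> z Sz; exists 0, z; rewrite scale0r add0r.
    move=> S'S; apply: nex; exists 0; rewrite scale0r subr0; apply: S'S.
    by exists 1, 0; rewrite scale1r addr0; split=> //; have [] := subS.
  split=> [[c [z [Sz e1]]]|]; last first.
    right; split; first by exists 0, 0; rewrite scale0r addr0; split=> //; have [] := subS.
    move=> d u v [c [z [Sz ->]]] [c' [z' [Sz' ->]]].
    exists (d * c + c'), (d *: z + z'); split; first exact: subS.2.
    by rewrite scalerDr scalerDl scalerA addrACA.
  have [c0|c0] := eqVneq c 0.
    by apply: nS1; rewrite e1 c0 scale0r add0r.
  apply: nex; exists c^-1; rewrite e1 scalerDr scalerA mulVf // scale1r.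
  rewrite opprD addrA subrr add0r -scaleNr -[_ *: _]addr0.
  by apply: subS.2 => //; have [] := subS.
have [phi phiP] := choice ex.
have uniq x c : S (x - c *: 1) -> phi x = c.
  move=> Sc; apply/eqP; rewrite -subr_eq0; apply/eqP/S1.
  have := subS.2 (-1) _ _ (phiP x) Sc.
  by rewrite scaleN1r opprB addrA subrK scalerBl.
exists phi; last by apply: uniq; rewrite scale1r subrr; have [] := subS.
move=> c x y; apply: uniq.
have := subS.2 c _ _ (phiP x) (phiP y).
by rewrite scalerBr scalerA scalerDl opprD addrACA.
Qed.

End LinearForm.

Section TensorAlgebra.
Variables (F : fieldType) (P A : algType F).
Local Notation T := (tensor P A).

Definition tensor_mul (x y : T) : T :=
  tensor_lift (fun p a => tensor_lift (fun q b => (p * q) ⊗ (a * b)) y) x.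

Definition tensor_one : T := 1 ⊗ 1.

Let inner_bilin p a : is_bilinear (fun (q : P) (b : A) => (p * q) ⊗ (a * b)).
Proof.
have [Bl Br] := tens_bilinear P A.
split=> [b c q q'|q c b b'] /=.
- by rewrite mulrDr -scalerAr Bl.
- by rewrite mulrDr -scalerAr Br.
Qed.

Lemma tensor_liftE (W : lmodType F) (f g : P -> A -> W) x :
  (forall p a, f p a = g p a) -> tensor_lift f x = tensor_lift g x.
Proof. by move=> fg; apply: eq_bigr => z _; apply: fg. Qed.

Let outer_bilin y : is_bilinear (fun (p : P) (a : A) =>
  tensor_lift (fun q b => (p * q) ⊗ (a * b)) y).
Proof.
have [Bl Br] := tens_bilinear P A.
split=> [a c p p'|p c a a'] /=;
  rewrite /tensor_lift scaler_sumr -big_split /=; apply: eq_bigr => z _.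
- by rewrite mulrDl -scalerAl Bl.
- by rewrite mulrDl -scalerAl Br.
Qed.

Lemma tensor_mul_bilinear : is_bilinear tensor_mul.
Proof.
split=> [y|x]; first exact: (tensor_lift_linear (outer_bilin y)).
move=> c y y'; rewrite /tensor_mul /tensor_lift scaler_sumr -big_split /=.
by apply: eq_bigr => z _; apply: (tensor_lift_linear (inner_bilin _ _)).
Qed.

Lemma tensor_mul_tens p q a b :
  tensor_mul (p ⊗ a) (q ⊗ b) = (p * q) ⊗ (a * b).
Proof.
by rewrite /tensor_mul (tensor_lift_tens (outer_bilin _)) tensor_lift_tens.
Qed.

Let mulDl : left_distributive tensor_mul +%R.
Proof.
move=> x y z; have := (tensor_mul_bilinear.1 z) 1 x y.
by rewrite /= !scale1r.
Qed.
Let mulDr : right_distributive tensor_mul +%R.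
Proof.
move=> x y z; have := (tensor_mul_bilinear.2 x) 1 y z.
by rewrite /= !scale1r.
Qed.
Let mul0 x : tensor_mul 0 x = 0.
Proof. by apply: (addIr (tensor_mul 0 x)); rewrite -mulDl !add0r. Qed.
Let mulr0' x : tensor_mul x 0 = 0.
Proof. by apply: (addIr (tensor_mul x 0)); rewrite -mulDr !add0r. Qed.

Let tensor_ind (Q : T -> Prop) : Q 0 -> (forall x y, Q x -> Q y -> Q (x + y)) ->
  (forall p a, Q (p ⊗ a)) -> forall x, Q x.
Proof.
move=> Q0 QD Qt x; rewrite (tensor_sum x).
by apply: (big_ind Q) => // z _; apply: Qt.
Qed.

Lemma tensor_mulA : associative tensor_mul.
Proof.
move=> x y z; elim/tensor_ind: x => [|x x' IH IH'|p a].
- by rewrite !mul0.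
- by rewrite !mulDl IH IH'.
elim/tensor_ind: y => [|y y' IH IH'|q b].
- by rewrite !(mul0, mulr0').
- by rewrite mulDl !mulDr mulDl IH IH'.
elim/tensor_ind: z => [|z z' IH IH'|r d].
- by rewrite !mulr0'.
- by rewrite !mulDr IH IH'.
by rewrite !tensor_mul_tens !mulrA.
Qed.

Lemma tensor_mul1l : left_id tensor_one tensor_mul.
Proof.
move=> x; elim/tensor_ind: x => [|x y IH IH'|p a]; first by rewrite mulr0'.
  by rewrite mulDr IH IH'.
by rewrite tensor_mul_tens !mul1r.
Qed.

Lemma tensor_mul1r : right_id tensor_one tensor_mul.
Proof.
move=> x; elim/tensor_ind: x => [|x y IH IH'|p a]; first by rewrite mul0.
  by rewrite mulDl IH IH'.
by rewrite tensor_mul_tens !mulr1.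
Qed.

Lemma tensor_one_neq0 : tensor_one != 0.
Proof.
have [phi lphi phi1] := linear_form_at1 P.
have [psi lpsi psi1] := linear_form_at1 A.
pose f p a : F^o := phi p * psi a.
have f_bilin : is_bilinear f.
  split=> [a c p p'|p c a a'] /=; rewrite /f.
    by rewrite lphi mulrDl -scalerAl.
  by rewrite lpsi mulrDr -scalerAr.
apply/eqP => one0; have := tensor_lift_tens f_bilin 1 1.
rewrite -/tensor_one one0 /f phi1 psi1 mulr1.
rewrite (lin0 (tensor_lift_linear f_bilin)) => /esym/eqP.
by rewrite oner_eq0.
Qed.

HB.instance Definition _ := GRing.Zmodule_isNzRing.Build T
  tensor_mulA tensor_mul1l tensor_mul1r mulDl mulDr tensor_one_neq0.

Lemma tensor_scaleAl (c : F) (x y : T) : c *: (x * y) = (c *: x) * y.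
Proof. exact: esym (linZ (tensor_mul_bilinear.1 y) c x). Qed.

Lemma tensor_scaleAr (c : F) (x y : T) : c *: (x * y) = x * (c *: y).
Proof. exact: esym (linZ (tensor_mul_bilinear.2 x) c y). Qed.

HB.instance Definition _ := GRing.Lmodule_isLalgebra.Build F T tensor_scaleAl.
HB.instance Definition _ := GRing.Lalgebra_isAlgebra.Build F T tensor_scaleAr.

End TensorAlgebra.

(* A Z/2-grading on B is a family Bg : bool -> B -> Prop, where Bg false and  *)
(* Bg true are the even part B_0 and the odd part B_1; parities are added     *)
(* with (+) and multiplied with &&.                                           *)
Section Superalgebras.
Variables (F : fieldType) (B : algType F) (Bg : bool -> B -> Prop).

Record is_superalgebra : Prop := IsSuperalgebra {
  super_sub : forall i, is_subspace (Bg i);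
  super_add : forall x, exists x0 x1, [/\ Bg false x0, Bg true x1 & x = x0 + x1];
  super_direct : forall x, Bg false x -> Bg true x -> x = 0;
  super_mul : forall i j x y, Bg i x -> Bg j y -> Bg (i (+) j) (x * y)
}.

Definition supercommutative : Prop :=
  forall i j x y, Bg i x -> Bg j y -> x * y = (-1) ^+ (i && j) * (y * x).

Variable br : B -> B -> B.
Local Notation "{[ x , y ]}" := (br x y) (at level 0, x at level 99).

Record is_dot_bracket : Prop := IsDotBracket {
  db_superalgebra : is_superalgebra;
  db_supercommutative : supercommutative;
  db_bilinear : is_bilinear br;
  db_even : forall i j f g, Bg i f -> Bg j g -> Bg (i (+) j) {[f, g]};
  db_skew : forall i j f g, Bg i f -> Bg j g ->
    {[f, g]} = - ((-1) ^+ (i && j) * {[g, f]})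
}.

(* The three identities shared by Jordan and Poisson brackets, for a given    *)
(* map delta in the role of f |-> {f, 1}. In bracket_jacobi the factor of     *)
(* delta g * {h, f} is the Koszul sign of (f, g, h) |-> (g, h, f). The sign   *)
(* (-1)^(|g|(|f|+|h|)) often printed there is a misprint, wrong already for   *)
(* the contact bracket on F[xi] (x) F[t] (xi odd, {xi, xi} = 1, E 1 = 1,      *)
(* E xi = 0, D = d/dt): with f = h = xi and g = t, the left-hand side is 1,   *)
(* delta f = delta h = 0 and delta g * {h, f} = -1. The Poisson case          *)
(* delta = 0 is not affected.                                                 *)
Record bracket_identities (delta : B -> B) : Prop := BracketIdentities {
  bracket_leibniz : forall i j k f g h, Bg i f -> Bg j g -> Bg k h ->
    {[f, g * h]} =
      {[f, g]} * h + (-1) ^+ (i && j) * (g * {[f, h]}) - delta f * g * h;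
  bracket_jacobi : forall i j k f g h, Bg i f -> Bg j g -> Bg k h ->
    {[f, {[g, h]}]} - {[{[f, g]}, h]} - (-1) ^+ (i && j) * {[g, {[f, h]}]} =
      delta f * {[g, h]}
      + (-1) ^+ (i && (j (+) k)) * (delta g * {[h, f]})
      + (-1) ^+ (k && (i (+) j)) * (delta h * {[f, g]});
  bracket_odd_cube : forall x, Bg true x ->
    {[{[x, x]}, x]} = - ({[x, x]} * delta x)
}.

Definition is_jordan_bracket : Prop :=
  is_dot_bracket /\ bracket_identities (fun f => {[f, 1]}).

Definition is_poisson_superalgebra : Prop :=
  is_dot_bracket /\ bracket_identities (fun _ => 0).

Definition is_generalized_derivation (E : B -> B) : Prop :=
  linear E /\ (forall a b, E (a * b) = E a * b + a * E b - a * b * E 1).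

Definition parity_preserving (E : B -> B) : Prop :=
  forall i x, Bg i x -> Bg i (E x).

End Superalgebras.

Section TensorBracket.
Variables (F : fieldType) (P A : algType F) (Pg : bool -> P -> Prop).

(* P_i (x) A, as the span in P (x) A of the p (x) a with p in P_i.            *)
Definition tensor_grading (i : bool) (x : tensor P A) : Prop :=
  exists2 s : seq (P * A),
    (forall z, z \in s -> Pg i z.1) & x = \sum_(z <- s) z.1 ⊗ z.2.

(* br is the bilinear product with the prescribed values on homogeneous pure  *)
(* tensors.                                                                   *)
Definition is_tensor_bracket (Pbr : P -> P -> P) (E : P -> P) (D : A -> A)
    (br : tensor P A -> tensor P A -> tensor P A) : Prop :=
  is_bilinear br /\
  (forall i j p q a b, Pg i p -> Pg j q ->
    br (p ⊗ a) (q ⊗ b) =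
      Pbr p q ⊗ (a * b) + (E p * q) ⊗ (a * D b)
      - (-1) ^+ (i && j) *: ((E q * p) ⊗ (D a * b))).

End TensorBracket.

(* Main.v *)
(* Supercommutativity turns the sign in <p (x) a, q (x) b> into the order of  *)
(* the factors: with E and D extended to T = P (x) A as E (x) id and id (x) D *)
(* and {,} extended A-bilinearly,                                             *)
(*                 <x, y> = {x, y} + E x * D y - D x * E y.                   *)
(* T is again a Poisson superalgebra, E is a generalized derivation of it     *)
(* compatible with {,}, and D is an even derivation of both products that     *)
(* commutes with E. For every Poisson superalgebra with such E and D the      *)
(* displayed formula is a Jordan bracket, with <x, 1> = - D x * E 1.          *)

(* The proof separates a computation free of tensors, [twisted_jordan], from the transport of the
   Poisson axioms to [P ⊗ A], [tensor_poisson]. In the computation, the corrections in [E 1] turn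
   Poisson identities into Jordan ones. Expanding E(gh) in <f, gh> leaves D(f) g h E(1), which is -
   <f, 1> g h. Expanding E({g, h}) in the Jacobi expression leaves - D(f) {g, h} E(1) = <f, 1> {g,
   h}, and likewise for the other two arguments. The remaining terms with one bracket cancel by the
   Leibniz rule and skew-symmetry, those with second derivatives because D and E commute. The
   bracket-free terms in E(1) form, on either side, up to sign the graded cyclic sum of D(f) (E(g)
   D(h) - D(g) E(h)), which is zero by supercommutativity. Being even, E(1) is central. For the
   transport, A is commutative of degree zero, so a multilinear identity needs checking only on
   homogeneous pure tensors, where it is the identity of P; the identity for odd cubes is polarized.
   As such tensors span, the formula determines the bracket ([bilinear_homog_eq]). *)
Require Import Defs.
From HB Require Import structures.
From mathcomp Require Import all_boot all_algebra.
From mathcomp Require Import boolp.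
Set Implicit Arguments.
Unset Strict Implicit.
Unset Printing Implicit Defensive.
Import GRing.Theory.
Local Open Scope ring_scope.

(** * Deciding integer-linear identities by reflection *)

(* The bracket is nonassociative and the product noncommutative, so that ring *)
(* does not apply; zmod decides identities between Z-linear combinations.     *)
Inductive zexp := ZVar of nat | ZZero | ZAdd of zexp & zexp | ZOpp of zexp.

Fixpoint zeval (V : zmodType) (env : seq V) e :=
  match e with
  | ZVar n => env`_n
  | ZZero => 0
  | ZAdd e1 e2 => zeval env e1 + zeval env e2
  | ZOpp e1 => - zeval env e1
  end.

Fixpoint zcoef (e : zexp) (i : nat) : int :=
  match e with
  | ZVar n => (n == i)%:Z
  | ZZero => 0
  | ZAdd e1 e2 => zcoef e1 i + zcoef e2 i
  | ZOpp e1 => - zcoef e1 i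
  end.

Lemma zevalE (V : zmodType) (env : seq V) e :
  zeval env e = \sum_(i < size env) env`_i *~ zcoef e i.
Proof.
elim: e => [n||e1 IH1 e2 IH2|e IH] /=.
- have [ltn|len] := ltnP n (size env); last first.
    (* An index past the end of [env] reads the default value 0, and its coefficient is 0 at every
       [i] below [size env]. *)
    rewrite nth_default // big1 // => i _.
    by rewrite gtn_eqF // (leq_trans (ltn_ord i)).
  rewrite (bigD1 (Ordinal ltn)) //= eqxx big1 ?addr0 // => i.
  by rewrite -val_eqE eq_sym /= => /negPf->.
- by rewrite big1.
- by rewrite IH1 IH2 -big_split; apply: eq_bigr => i _; rewrite mulrzDr.
- by rewrite IH -sumrN; apply: eq_bigr => i _; rewrite mulrNz.
Qed.

Lemma zmod_decide (V : zmodType) (env : seq V) e1 e2 :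
  all (fun i => zcoef e1 i == zcoef e2 i) (iota 0 (size env)) ->
  zeval env e1 = zeval env e2.
Proof.
move=> /allP e12; rewrite !zevalE; apply: eq_bigr => i _.
by rewrite (eqP (e12 i _)) // mem_iota /=.
Qed.

(* Equality of atoms is syntactic up to the algebraic structures from which   *)
(* the operations are inferred.                                               *)
Ltac zmod_same x y :=
  lazymatch constr:((x, y)) with
  | (?a * ?b, ?c * ?d) => zmod_same a c; zmod_same b d
  | (?a *: ?b, ?c *: ?d) => zmod_same a c; zmod_same b d
  | (?a + ?b, ?c + ?d) => zmod_same a c; zmod_same b d
  | (- ?a, - ?c) => zmod_same a c
  | (?a ^+ ?n, ?c ^+ ?m) => constr_eq n m; zmod_same a c
  | (1, 1) => idtac
  | (?f ?a, ?g ?b) => constr_eq f g; zmod_same a b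
  | _ => constr_eq x y
  end.

(** Running [zmod_same] under [match constr:(Set)] executes it while the index is being built, so
    that its failure selects the branch that searches further. *)
Ltac zmod_index x env :=
  lazymatch env with
  | ?y :: ?env' =>
    match constr:(Set) with
    | _ => let _ := match constr:(Set) with _ => zmod_same x y end in constr:(0%N)
    | _ => let n := zmod_index x env' in constr:(n.+1)
    end
  end.

Ltac zmod_atoms x env :=
  lazymatch x with
  | 0 => env
  | ?a + ?b => let env := zmod_atoms a env in zmod_atoms b env
  | - ?a => zmod_atoms a env
  | _ => match constr:(Set) with
         | _ => let _ := zmod_index x env in env
         | _ => constr:(x :: env)
         end
  end.

Ltac zmod_reify x env :=
  lazymatch x with
  | 0 => constr:(ZZero)
  | ?a + ?b => let a := zmod_reify a env in let b := zmod_reify b env in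
               constr:(ZAdd a b)
  | - ?a => let a := zmod_reify a env in constr:(ZOpp a)
  | _ => let n := zmod_index x env in constr:(ZVar n)
  end.

Ltac zmod :=
  lazymatch goal with
  | |- @eq ?V ?x ?y =>
    let env := zmod_atoms x (@nil V) in
    let env := zmod_atoms y env in
    let ex := zmod_reify x env in
    let ey := zmod_reify y env in
    apply: (@zmod_decide _ env ex ey); vm_compute; reflexivity
  end.

(** * Elementary facts on superalgebras *)

Section SuperalgebraFacts.
Variables (F : fieldType) (B : algType F) (Bg : bool -> B -> Prop).
Hypothesis superB : is_superalgebra Bg.

Lemma homog0 i : Bg i 0.
Proof. exact: (super_sub superB i).1. Qed.

Lemma homogD i x y : Bg i x -> Bg i y -> Bg i (x + y).
Proof.
by move=> Bx By; rewrite -[x]scale1r; apply: (super_sub superB i).2.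
Qed.

Lemma homogN i x : Bg i x -> Bg i (- x).
Proof.
move=> Bx; rewrite -[- x]addr0 -scaleN1r.
exact: (super_sub superB i).2 Bx (homog0 i).
Qed.

(** The odd component v of 1 = u + v kills every homogeneous x: x v = x - x u has both the parity of
    x and the opposite one. Hence v = (u + v) v = 0. *)
Lemma homog1 : Bg false 1.
Proof.
have [u [v [Bu Bv e1]]] := super_add superB 1.
suff v0 : v = 0 by rewrite e1 v0 addr0.
have kill i x : Bg i x -> x * v = 0.
  move=> Bx; have xv : x * v = x - x * u.
    by rewrite -[X in X - _]mulr1 e1 mulrDr addrC addKr.
  have Bxv := super_mul superB Bx Bv.
  have Bxu : Bg i (x * v).
    by rewrite xv; apply/homogD/homogN => //; rewrite -[i]addbF; apply: super_mul.
  by case: i Bx Bxv Bxu => /= _ ? ?; apply: (super_direct superB).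
by rewrite -[v]mul1r e1 mulrDl (kill _ _ Bu) (kill _ _ Bv) addr0.
Qed.

Lemma homog_dec x (Q : B -> Prop) :
  (forall y z, Q y -> Q z -> Q (y + z)) -> (forall i y, Bg i y -> Q y) -> Q x.
Proof.
move=> QD Qh; have [x0 [x1 [B0 B1 ->]]] := super_add superB x.
by apply: QD; [apply: Qh B0 | apply: Qh B1].
Qed.

Lemma even_central (scB : supercommutative Bg) x y : Bg false x -> x * y = y * x.
Proof.
move=> Bx; elim/homog_dec: y => [y z xy xz|i y By].
  by rewrite mulrDr mulrDl xy xz.
by rewrite (scB _ _ _ _ Bx By) mul1r.
Qed.

End SuperalgebraFacts.

(** * The twisted bracket on an abstract Poisson superalgebra *)

Section JordanFromPoisson.
Variables (F : fieldType) (B : algType F) (Bg : bool -> B -> Prop).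
Variable br : B -> B -> B.
Hypothesis charF : 2%N \notin [pchar F].
Hypothesis poissonB : is_poisson_superalgebra Bg br.
Local Notation "{[ x , y ]}" := (br x y) (at level 0, x at level 99).

Variable E : B -> B.
Hypothesis derE : is_generalized_derivation E.
Hypothesis parE : parity_preserving Bg E.
Hypothesis brE : forall x y,
  E {[x, y]} = {[E x, y]} + {[x, E y]} + {[x, y]} * E 1.

Variable D : B -> B.
Hypothesis derD : is_derivation D.
Hypothesis parD : parity_preserving Bg D.
Hypothesis brD : forall x y, D {[x, y]} = {[D x, y]} + {[x, D y]}.
Hypothesis DE : forall x, D (E x) = E (D x).

Definition twisted_bracket x y := {[x, y]} + E x * D y - D x * E y.
Local Notation "<[ x , y ]>" := (twisted_bracket x y).

Let dbB := poissonB.1.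
Let superB := db_superalgebra dbB.
Let scB := db_supercommutative dbB.

Let brDl x y z : {[x + y, z]} = {[x, z]} + {[y, z]}.
Proof. exact: linD ((db_bilinear dbB).1 z) x y. Qed.

Let brDr x y z : {[x, y + z]} = {[x, y]} + {[x, z]}.
Proof. exact: linD ((db_bilinear dbB).2 x) y z. Qed.

Let brNl x y : {[- x, y]} = - {[x, y]}.
Proof.
by rewrite -scaleN1r (linZ ((db_bilinear dbB).1 y)) scaleN1r.
Qed.

Let brNr x y : {[x, - y]} = - {[x, y]}.
Proof.
by rewrite -scaleN1r (linZ ((db_bilinear dbB).2 x)) scaleN1r.
Qed.

Let ED := linD derE.1.
Let DD := linD derD.1.
Let EN x : E (- x) = - E x.
Proof. by rewrite -scaleN1r (linZ derE.1) scaleN1r. Qed.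
Let DN x : D (- x) = - D x.
Proof. by rewrite -scaleN1r (linZ derD.1) scaleN1r. Qed.
Let EM := derE.2.
Let DM := derD.2.

Let signs := (@expr0 B, @expr1 B, @mul1r B, @mulN1r B, @opprK B).

Lemma poisson_leibnizr i j k f g h : Bg i f -> Bg j g -> Bg k h ->
  {[f, g * h]} = {[f, g]} * h + (-1) ^+ (i && j) * (g * {[f, h]}).
Proof.
move=> Bf Bgg Bh; rewrite (bracket_leibniz poissonB.2 Bf Bgg Bh).
by rewrite !mul0r subr0.
Qed.

(** Skew-symmetry carries the other Leibniz rule over. It yields {f, h} g in the reverse order,
    which supercommutativity repairs; the signs depend only on the parities, hence eight cases. *)
Lemma poisson_leibnizl i j k f g h : Bg i f -> Bg j g -> Bg k h ->
  {[f * g, h]} = f * {[g, h]} + (-1) ^+ (i && j) * (g * {[f, h]}).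
Proof.
move=> Bf Bgg Bh.
rewrite (db_skew dbB (super_mul superB Bf Bgg) Bh).
rewrite (poisson_leibnizr Bh Bf Bgg) (db_skew dbB Bh Bf) (db_skew dbB Bh Bgg).
rewrite mulrDr opprD [RHS]addrC; congr (_ + _).
  have := scB Bgg (db_even dbB Bf Bh).
  by move: i j k {Bf Bgg Bh} => [] [] [] /= ->; rewrite !signs ?mulNr ?mulrN ?signs.
by move: i j k {Bf Bgg Bh} => [] [] [] /=; rewrite !signs ?mulNr ?mulrN ?signs.
Qed.

(** The Leibniz rule at g = h = 1, with 1 even, reads {f, 1} = {f, 1} + {f, 1}. *)
Lemma poisson_bracket1 f : {[f, 1]} = 0.
Proof.
elim/(homog_dec superB): f => [x y x0 y0|i f Bf]; first by rewrite brDl x0 y0 addr0.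
have B1 := homog1 superB.
have := poisson_leibnizr Bf B1 B1.
rewrite !mulr1 andbF !signs -{1}[{[f, 1]}]addr0.
by move/addrI.
Qed.

Lemma derivation1 : D 1 = 0.
Proof.
by have := DM 1 1; rewrite !mulr1 mul1r -{1}[D 1]addr0 => /addrI.
Qed.

Lemma E1_central x : E 1 * x = x * E 1.
Proof. exact/(even_central superB scB)/parE/(homog1 superB). Qed.

(** As a rewriting rule this collects [E 1] at the right end of products, the normal form in which
    [zmod] compares terms. *)
Lemma E1_mulrAC x y : x * E 1 * y = x * y * E 1.
Proof. by rewrite -mulrA E1_central mulrA. Qed.

Lemma twisted_bracket1 f : <[f, 1]> = - (D f * E 1).
Proof.
by rewrite /twisted_bracket poisson_bracket1 derivation1 mulr0 !add0r.
Qed.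

Lemma twisted_even i j f g :
  Bg i f -> Bg j g -> Bg (i (+) j) <[f, g]>.
Proof.
move=> Bf Bgg; apply: (homogD superB); [|apply: (homogN superB)].
  apply: (homogD superB); first exact: (db_even dbB).
  exact: (super_mul superB (parE Bf) (parD Bgg)).
exact: (super_mul superB (parD Bf) (parE Bgg)).
Qed.

Lemma twisted_skew i j f g : Bg i f -> Bg j g ->
  <[f, g]> = - ((-1) ^+ (i && j) * <[g, f]>).
Proof.
move=> Bf Bgg; rewrite /twisted_bracket (db_skew dbB Bf Bgg).
rewrite (scB (parE Bf) (parD Bgg)) (scB (parD Bf) (parE Bgg)).
rewrite !(mulrDr, mulrN); zmod.
Qed.

Lemma twisted_bilinear : is_bilinear twisted_bracket.
Proof.
split=> [y|x] c u v; rewrite /twisted_bracket.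
  rewrite (db_bilinear dbB).1 derE.1 derD.1 !mulrDl -!scalerAl !scalerDr scalerN.
  zmod.
rewrite (db_bilinear dbB).2 derE.1 derD.1 !mulrDr -!scalerAr !scalerDr scalerN.
zmod.
Qed.

Lemma twisted_dot_bracket : is_dot_bracket Bg twisted_bracket.
Proof.
split; first exact: superB.
- exact: scB.
- exact: twisted_bilinear.
- exact: twisted_even.
- exact: twisted_skew.
Qed.

(** The Leibniz rules of the Poisson bracket and of [D] account for the first two terms; the
    correction in [E (g * h)] is the third. *)
Lemma twisted_leibniz i j k f g h : Bg i f -> Bg j g -> Bg k h ->
  <[f, g * h]> = <[f, g]> * h + (-1) ^+ (i && j) * (g * <[f, h]>)
                 - <[f, 1]> * g * h.
Proof.
move=> Bf Bgg Bh; rewrite twisted_bracket1 /twisted_bracket.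
rewrite (poisson_leibnizr Bf Bgg Bh) DM EM.
have := scB Bgg (parE Bf); have := scB Bgg (parD Bf); rewrite andbC.
case: (i && j) => /= gE gD; rewrite !signs in gE gD *;
  by rewrite !(mulrDl, mulrDr, mulNr, mulrN, mulrA, gE, gD, opprD, opprK,
               E1_mulrAC); zmod.
Qed.

Lemma twisted_jacobi i j k f g h : Bg i f -> Bg j g -> Bg k h ->
  <[f, <[g, h]>]> - <[<[f, g]>, h]> - (-1) ^+ (i && j) * <[g, <[f, h]>]> =
    <[f, 1]> * <[g, h]>
    + (-1) ^+ (i && (j (+) k)) * (<[g, 1]> * <[h, f]>)
    + (-1) ^+ (k && (i (+) j)) * (<[h, 1]> * <[f, g]>).
Proof.
move=> Bf Bgg Bh.
(* The right-hand side is first reordered so that its only sign is that of (f, g): its last term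
   becomes [<[f, g]> * <[h, 1]>], and skew-symmetry turns <h, f> into <f, h> in the middle one. *)
have Bh1 : Bg k <[h, 1]>.
  by rewrite -[k]addbF; apply: twisted_even Bh (homog1 superB).
rewrite (scB Bh1 (twisted_even Bf Bgg)) mulrA -signr_addb addbb expr0 mul1r.
have -> : (-1) ^+ (i && (j (+) k)) * (<[g, 1]> * <[h, f]>) =
    - ((-1) ^+ (i && j) * (<[g, 1]> * <[f, h]>)).
  rewrite (twisted_skew Bh Bf) mulrN mulrN !mulrA; congr (- _).
  rewrite -[_ * <[g, 1]> * _]mulrA commr_sign mulrA -signr_addb.
  by case: i j k {Bf Bgg Bh Bh1} => [] [] [].
rewrite !twisted_bracket1.
have jac := bracket_jacobi poissonB.2 Bf Bgg Bh.
rewrite !mul0r !mulr0 !addr0 in jac.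
(* The Jacobi identity is solved for the left-nested bracket, which rewriting then eliminates. *)
have {}jac : {[{[f, g]}, h]} =
    {[f, {[g, h]}]} - (-1) ^+ (i && j) * {[g, {[f, h]}]}.
  by apply/eqP; rewrite -subr_eq0; apply/eqP; rewrite -[RHS]oppr0 -jac; zmod.
have [Ef Eg Eh] := And3 (parE Bf) (parE Bgg) (parE Bh).
have [Df Dg Dh] := And3 (parD Bf) (parD Bgg) (parD Bh).
(* Once the sign of (f, g) is fixed, every term has a normal form with f      *)
(* before g before h and E 1 last, except that g * {f, h} is left as it is.   *)
have gf x y : Bg j x -> Bg i y -> x * y = (-1) ^+ (i && j) * (y * x).
  by move=> Bx By; rewrite (scB Bx By) andbC.
have {}gf := (gf _ _ Eg (parE Df), gf _ _ Eg Ef, gf _ _ Eg (parD Df),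
              gf _ _ Eg Df, gf _ _ Dg (parE Ef), gf _ _ Dg Ef,
              gf _ _ Dg (parE Df), gf _ _ Dg Df).
rewrite /twisted_bracket.
rewrite !(brDl, brDr, brNl, brNr, ED, EN, DD, DN, EM, DM, brE, brD, DE) jac.
rewrite !(poisson_leibnizr Bf Eg Dh, poisson_leibnizr Bf Dg Eh,
  poisson_leibnizr Bgg Ef Dh, poisson_leibnizr Bgg Df Eh,
  poisson_leibnizl Ef Dg Bh, poisson_leibnizl Df Eg Bh).
rewrite (db_skew dbB Bgg Ef) (db_skew dbB Bgg Df) (andbC j i).
case: (i && j) gf {jac} => /= gf; rewrite !signs in gf *;
  rewrite !(mulrDl, mulrDr, mulNr, mulrN, opprD, opprK);
  rewrite !mulrA !E1_mulrAC !gf ?mulNr ?opprK; zmod.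
Qed.

(** Supercommutativity gives 2 x^2 = 0; this is where the characteristic enters. *)
Lemma odd_square x : Bg true x -> x * x = 0.
Proof.
move=> Bx; have := scB Bx Bx; rewrite !signs => /eqP.
rewrite -addr_eq0 -mulr2n -scaler_nat scaler_eq0 => /orP[two0|/eqP //].
by case/negP: charF; rewrite inE /= two0.
Qed.

(** Here <x, x> = {x, x} + 2 E(x) D(x). Terms containing {E x, x} or {D x, x} cancel because these
    brackets are even, hence central; bracket-free terms cancel because [E x] and [D x] anticommute
    and square to zero. There remains {x, x} D(x) E(1), from [brE]. *)
Lemma twisted_odd_cube x : Bg true x ->
  <[<[x, x]>, x]> = - (<[x, x]> * <[x, 1]>).
Proof.
move=> Bx; rewrite twisted_bracket1.
have [Ex Dx] := (parE Bx, parD Bx).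
have cube := bracket_odd_cube poissonB.2 Bx; rewrite mulr0 oppr0 in cube.
have anti y z : Bg true y -> Bg true z -> y * z = - (z * y).
  by move=> By Bz; rewrite (scB By Bz) !signs.
rewrite /twisted_bracket.
rewrite !(brDl, brDr, brNl, brNr, ED, EN, DD, DN, EM, DM, brE, brD, DE) cube.
rewrite (poisson_leibnizl Ex Dx Bx) (poisson_leibnizl Dx Ex Bx) /= !signs.
rewrite (db_skew dbB Bx Ex) (db_skew dbB Bx Dx) /= !signs.
have brc y : Bg true y -> forall z, z * {[y, x]} = {[y, x]} * z.
  by move=> By z; rewrite (even_central superB scB z (db_even dbB By Bx)).
rewrite (brc _ Ex) (brc _ Dx).
have swap := (anti _ _ Ex (parE Dx), anti _ _ Dx (parE Ex), anti _ _ Ex (parD Dx),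
              anti _ _ Dx (parE Dx), anti _ _ Dx Ex).
have kill y z : Bg true z -> y * z * z = 0.
  by move=> Bz; rewrite -mulrA odd_square // mulr0.
have last y : y * D x * E x = - (y * E x * D x).
  by rewrite -mulrA (anti _ _ Dx Ex) mulrN mulrA.
rewrite !(mulrDl, mulrDr, mulNr, mulrN, opprD, opprK).
rewrite !mulrA !E1_mulrAC !swap ?mulNr ?opprK.
rewrite !last !(kill _ _ Dx, kill _ _ Ex) ?mul0r ?opprK; zmod.
Qed.

Lemma twisted_jordan : is_jordan_bracket Bg twisted_bracket.
Proof.
split; first exact: twisted_dot_bracket.
split; [exact: twisted_leibniz|exact: twisted_jacobi|exact: twisted_odd_cube].
Qed.

End JordanFromPoisson.

(** * Maps and brackets on the tensor product *)

Section TensorCalculus.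
Variables (F : fieldType) (P A : algType F).
Local Notation T := (tensor P A).
Implicit Types (p q : P) (a b : A) (x y : T).

Lemma tensDl p q a : (p + q) ⊗ a = p ⊗ a + q ⊗ a.
Proof. exact: linD ((tens_bilinear P A).1 a) p q. Qed.

Lemma tensDr p a b : p ⊗ (a + b) = p ⊗ a + p ⊗ b.
Proof. exact: linD ((tens_bilinear P A).2 p) a b. Qed.

Lemma tensZl c p a : (c *: p) ⊗ a = c *: (p ⊗ a).
Proof. exact: linZ ((tens_bilinear P A).1 a) c p. Qed.

Lemma tensZr c p a : p ⊗ (c *: a) = c *: (p ⊗ a).
Proof. exact: linZ ((tens_bilinear P A).2 p) c a. Qed.

Lemma tens0l a : 0 ⊗ a = 0 :> T.
Proof. exact: lin0 ((tens_bilinear P A).1 a). Qed.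

Lemma tensNl p a : (- p) ⊗ a = - (p ⊗ a).
Proof. by rewrite -scaleN1r tensZl scaleN1r. Qed.

Lemma tensM p q a b : (p ⊗ a) * (q ⊗ b) = (p * q) ⊗ (a * b).
Proof. exact: tensor_mul_tens. Qed.

Lemma sign_tens (s : bool) p a :
  (-1) ^+ s * (p ⊗ a) = ((-1) ^+ s * p) ⊗ a.
Proof. by rewrite !mulr_sign; case: s; rewrite ?tensNl. Qed.

(** Applied to the difference of the two sides of an identity, one argument at a time; additivity
    suffices because every tensor is a sum of pure ones. *)
Lemma additive_tensor_eq0 (W : zmodType) (u : T -> W) :
  {morph u : x y / x + y} -> (forall p a, u (p ⊗ a) = 0) -> forall x, u x = 0.
Proof.
move=> uD u0 x; have u00 : u 0 = 0 by apply: (addIr (u 0)); rewrite -uD !add0r.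
by rewrite (tensor_sum x) (big_morph u uD u00) big1.
Qed.

Definition tensor_map (g : P -> P) (h : A -> A) : T -> T :=
  tensor_lift (fun p a => g p ⊗ h a).

Section TensorMap.
Variables (g : P -> P) (h : A -> A).
Hypotheses (g_lin : linear g) (h_lin : linear h).

Let map_bilin : is_bilinear (fun p a => g p ⊗ h a).
Proof.
by split=> [a c p q|p c a b]; rewrite ?g_lin ?h_lin ?tensDl ?tensDr ?tensZl ?tensZr.
Qed.

Lemma tensor_map_linear : linear (tensor_map g h).
Proof. exact: tensor_lift_linear map_bilin. Qed.

Lemma tensor_map_tens p a : tensor_map g h (p ⊗ a) = g p ⊗ h a.
Proof. exact: tensor_lift_tens map_bilin p a. Qed.

End TensorMap.

(* The A-bilinear extension of br to P (x) A.                                 *)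
Definition tensor_bracket (br : P -> P -> P) (x y : T) : T :=
  tensor_lift (fun p a => tensor_lift (fun q b => br p q ⊗ (a * b)) y) x.

Section TensorBracketFacts.
Variable br : P -> P -> P.
Hypothesis br_bilin : is_bilinear br.

Let inner_bilin p a : is_bilinear (fun q b => br p q ⊗ (a * b)).
Proof.
split=> [b c q q'|q c b b'] /=; first by rewrite br_bilin.2 tensDl tensZl.
by rewrite mulrDr -scalerAr tensDr tensZr.
Qed.

Let outer_bilin y :
  is_bilinear (fun p a => tensor_lift (fun q b => br p q ⊗ (a * b)) y).
Proof.
(* For fixed [y] all the sums run over the same representative [repr y], so they are compared term
   by term. *)
split=> [a c p p'|p c a a'] /=;
  rewrite /tensor_lift scaler_sumr -big_split /=; apply: eq_bigr => z _.
- by rewrite br_bilin.1 tensDl tensZl.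
- by rewrite mulrDl -scalerAl tensDr tensZr.
Qed.

Lemma tensor_bracket_bilinear : is_bilinear (tensor_bracket br).
Proof.
split=> [y|x]; first exact: (tensor_lift_linear (outer_bilin y)).
move=> c y y'; rewrite /tensor_bracket /tensor_lift scaler_sumr -big_split /=.
by apply: eq_bigr => z _; apply: (tensor_lift_linear (inner_bilin _ _)).
Qed.

Lemma tensor_bracket_tens p q a b :
  tensor_bracket br (p ⊗ a) (q ⊗ b) = br p q ⊗ (a * b).
Proof.
by rewrite /tensor_bracket (tensor_lift_tens (outer_bilin _)) tensor_lift_tens.
Qed.

Lemma tensor_bracketDl x x' y :
  tensor_bracket br (x + x') y = tensor_bracket br x y + tensor_bracket br x' y.
Proof. exact: linD (tensor_bracket_bilinear.1 y) x x'. Qed.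

Lemma tensor_bracketDr x y y' :
  tensor_bracket br x (y + y') = tensor_bracket br x y + tensor_bracket br x y'.
Proof. exact: linD (tensor_bracket_bilinear.2 x) y y'. Qed.

End TensorBracketFacts.

End TensorCalculus.

(** * The grading of the tensor product *)

Section TensorGrading.
Variables (F : fieldType) (P A : algType F) (Pg : bool -> P -> Prop).
Hypothesis superP : is_superalgebra Pg.
Local Notation T := (tensor P A).
Local Notation Tg := (@tensor_grading F P A Pg).

Lemma tensor_grading_tens i p (a : A) : Pg i p -> Tg i (p ⊗ a).
Proof.
move=> Pp; exists [:: (p, a)]; last by rewrite big_seq1.
by move=> z; rewrite inE => /eqP->.
Qed.

Lemma tensor_grading_subspace i : is_subspace (Tg i).
Proof.
split; first by exists [::]; rewrite ?big_nil.
move=> c _ _ [s Ps ->] [t Pt ->].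
exists ([seq (c *: z.1, z.2) | z <- s] ++ t).
  move=> z; rewrite mem_cat => /orP[/mapP[w sw ->]|/Pt//] /=.
  by have := (super_sub superP i).2 c _ _ (Ps w sw) (homog0 superP i); rewrite addr0.
rewrite big_cat big_map scaler_sumr; congr (_ + _).
by apply: eq_bigr => z _; rewrite tensZl.
Qed.

Lemma tensor_gradingD i x y : Tg i x -> Tg i y -> Tg i (x + y).
Proof. by rewrite -{2}[x]scale1r; apply: (tensor_grading_subspace i).2. Qed.

Lemma tensor_grading_ind i (Q : T -> Prop) :
  Q 0 -> (forall x y, Q x -> Q y -> Q (x + y)) ->
  (forall p a, Pg i p -> Q (p ⊗ a)) -> forall x, Tg i x -> Q x.
Proof.
move=> Q0 QD Qt _ [s Ps ->]; rewrite big_seq.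
by apply: (big_ind Q) => // z /Ps; apply: Qt.
Qed.

Lemma additive_homog_eq0 i (W : zmodType) (u : T -> W) :
  {morph u : x y / x + y} -> (forall p a, Pg i p -> u (p ⊗ a) = 0) ->
  forall x, Tg i x -> u x = 0.
Proof.
move=> uD u0; apply: tensor_grading_ind => // [|x y x0 y0].
  by apply: (addIr (u 0)); rewrite -uD !add0r.
by rewrite uD x0 y0 addr0.
Qed.

(** This serves the directness of the tensor grading: an element of both parts comes as two
    unrelated sums, which a map defined on all of [P ⊗ A] can compare. Uniqueness of the even
    component makes the chosen function linear. *)
Lemma even_projection :
  exists pi : P -> P, [/\ linear pi, forall p, Pg false p -> pi p = p
                        & forall p, Pg true p -> pi p = 0].
Proof.
have ex p : exists q, Pg false q /\ Pg true (p - q).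
  have [p0 [p1 [P0 P1 ->]]] := super_add superP p.
  by exists p0; split=> //; rewrite addrAC subrr add0r.
have [pi piP] := choice ex.
have uniq p q : Pg false q -> Pg true (p - q) -> pi p = q.
  move=> Pq Ppq; apply/eqP; rewrite -subr_eq0; apply/eqP.
  have [P1 P2] := piP p; apply: (super_direct superP).
    exact: (homogD superP P1 (homogN superP Pq)).
  rewrite (_ : pi p - q = (p - q) - (p - pi p)); last by zmod.
  exact: (homogD superP Ppq (homogN superP P2)).
exists pi; split=> [c p q|p Pp|p Pp]; apply: uniq => //.
- exact: (super_sub superP false).2 (piP p).1 (piP q).1.
- rewrite (_ : _ - _ = c *: (p - pi p) + (q - pi q)).
    exact: (super_sub superP true).2 (piP p).2 (piP q).2.
  by rewrite scalerBr; zmod.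
- by rewrite subrr; apply: homog0.
- exact: homog0.
- by rewrite subr0.
Qed.

Lemma tensor_superalgebra : is_superalgebra Tg.
Proof.
split; first exact: tensor_grading_subspace.
- move=> x; rewrite (tensor_sum x).
  apply: (big_ind (fun y => exists y0 y1, [/\ Tg false y0, Tg true y1 & y = y0 + y1])).
  + by exists 0, 0; rewrite addr0; split=> //; exact: (tensor_grading_subspace _).1.
  + move=> _ _ [x0 [x1 [X0 X1 ->]]] [y0 [y1 [Y0 Y1 ->]]].
    exists (x0 + y0), (x1 + y1); split; [exact: tensor_gradingD..|].
    by rewrite addrACA.
  + move=> [p a] _ /=; have [p0 [p1 [P0 P1 ->]]] := super_add superP p.
    by exists (p0 ⊗ a), (p1 ⊗ a); split; rewrite ?tensDl //; apply: tensor_grading_tens.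
(* The map [tensor_map pi id] is the identity on the even part and zero on the odd part, so an
   element of both is zero. *)
- have [pi [pi_lin pi0 pi1]] := even_projection.
  have id_lin : linear (@id A) by [].
  have lin := tensor_map_linear pi_lin id_lin.
  have val := tensor_map_tens pi_lin id_lin.
  move=> x X0 X1; apply: etrans (_ : tensor_map pi id x = 0).
    apply/esym/eqP; rewrite -subr_eq0; apply/eqP; move: x X0 {X1}.
    apply: additive_homog_eq0 => [x y|p a Pp]; first by rewrite (linD lin); zmod.
    by rewrite val pi0 // subrr.
  move: x X1 {X0}; apply: additive_homog_eq0 => [x y|p a Pp]; first exact: linD lin x y.
  by rewrite val pi1 // tens0l.
- move=> i j x y Tx Ty; move: x Tx; apply: tensor_grading_ind.
  + by rewrite mul0r; have [] := tensor_grading_subspace (i (+) j).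
  + by move=> x x'; rewrite mulrDl; apply: tensor_gradingD.
  move=> p a Pp; move: y Ty; apply: tensor_grading_ind.
  + by rewrite mulr0; have [] := tensor_grading_subspace (i (+) j).
  + by move=> y y'; rewrite mulrDr; apply: tensor_gradingD.
  by move=> q b Pq; rewrite tensM; exact/tensor_grading_tens/(super_mul superP).
Qed.

(** Homogeneous pure tensors span [P ⊗ A]; this yields the uniqueness of the bracket. *)
Lemma bilinear_homog_eq (W : lmodType F) (f g : T -> T -> W) :
  is_bilinear f -> is_bilinear g ->
  (forall i j p q a b, Pg i p -> Pg j q ->
     f (p ⊗ a) (q ⊗ b) = g (p ⊗ a) (q ⊗ b)) ->
  f =2 g.
Proof.
move=> [fl fr] [gl gr] fg x y.
have fDl x1 x2 z : f (x1 + x2) z = f x1 z + f x2 z := linD (fl z) x1 x2.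
have fDr z y1 y2 : f z (y1 + y2) = f z y1 + f z y2 := linD (fr z) y1 y2.
have gDl x1 x2 z : g (x1 + x2) z = g x1 z + g x2 z := linD (gl z) x1 x2.
have gDr z y1 y2 : g z (y1 + y2) = g z y1 + g z y2 := linD (gr z) y1 y2.
elim/(homog_dec tensor_superalgebra): x => [x x' ex ex'|i x Tx].
  by rewrite fDl ex ex' gDl.
elim/(homog_dec tensor_superalgebra): y => [y y' ey ey'|j y Ty].
  by rewrite fDr ey ey' gDr.
apply/eqP; rewrite -subr_eq0; apply/eqP; move: x Tx.
apply: additive_homog_eq0 => [x x'|p a Pp]; first by rewrite fDl gDl; zmod.
move: y Ty; apply: additive_homog_eq0 => [y y'|q b Pq].
  by rewrite fDr gDr; zmod.
by rewrite (fg i j) // subrr.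
Qed.

End TensorGrading.

(** * The Poisson structure of the tensor product *)

Section TensorPoisson.
Variables (F : fieldType) (P : algType F) (A : comAlgType F).
Variables (Pg : bool -> P -> Prop) (Pbr : P -> P -> P).
Hypothesis poissonP : is_poisson_superalgebra Pg Pbr.
Local Notation T := (tensor P A).
Local Notation Tg := (@tensor_grading F P A Pg).
Local Notation br := (@tensor_bracket F P A Pbr).

Let dbP := poissonP.1.
Let superP := db_superalgebra dbP.
Let brDl := @tensor_bracketDl F P A Pbr (db_bilinear dbP).
Let brDr := @tensor_bracketDr F P A Pbr (db_bilinear dbP).
Let br_tens := @tensor_bracket_tens F P A Pbr (db_bilinear dbP).

Let distr := (brDl, brDr, @mulrDl T, @mulrDr T, @opprD T).

Lemma tensor_supercommutative : supercommutative Tg.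
Proof.
move=> i j x y Tx Ty; apply/eqP; rewrite -subr_eq0; apply/eqP.
move: x Tx; apply: additive_homog_eq0 => [x x'|p a Pp]; first by rewrite !distr; zmod.
move: y Ty; apply: additive_homog_eq0 => [y y'|q b Pq]; first by rewrite !distr; zmod.
by rewrite !tensM sign_tens -(db_supercommutative dbP Pp Pq) (mulrC b) subrr.
Qed.

Lemma tensor_bracket_even i j x y : Tg i x -> Tg j y -> Tg (i (+) j) (br x y).
Proof.
have T0 k := (tensor_grading_subspace A superP k).1.
move=> Tx Ty; move: x Tx; apply: tensor_grading_ind.
- by rewrite (lin0 ((tensor_bracket_bilinear A (db_bilinear dbP)).1 y)).
- by move=> x x'; rewrite brDl; apply: tensor_gradingD.
move=> p a Pp; move: y Ty; apply: tensor_grading_ind.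
- by rewrite (lin0 ((tensor_bracket_bilinear A (db_bilinear dbP)).2 (p ⊗ a))).
- by move=> y y'; rewrite brDr; apply: tensor_gradingD.
by move=> q b Pq; rewrite br_tens; apply/tensor_grading_tens/(db_even dbP).
Qed.

Lemma tensor_bracket_skew i j x y : Tg i x -> Tg j y ->
  br x y = - ((-1) ^+ (i && j) * br y x).
Proof.
move=> Tx Ty; apply/eqP; rewrite -subr_eq0; apply/eqP.
move: x Tx; apply: additive_homog_eq0 => [x x'|p a Pp]; first by rewrite !distr; zmod.
move: y Ty; apply: additive_homog_eq0 => [y y'|q b Pq]; first by rewrite !distr; zmod.
by rewrite !br_tens sign_tens -tensNl -(db_skew dbP Pp Pq) (mulrC b) subrr.
Qed.

Lemma tensor_leibniz i j k x y z : Tg i x -> Tg j y -> Tg k z ->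
  br x (y * z) = br x y * z + (-1) ^+ (i && j) * (y * br x z).
Proof.
move=> Tx Ty Tz; apply/eqP; rewrite -subr_eq0; apply/eqP.
move: x Tx; apply: additive_homog_eq0 => [x x'|p a Pp]; first by rewrite !distr; zmod.
move: y Ty; apply: additive_homog_eq0 => [y y'|q b Pq]; first by rewrite !distr; zmod.
move: z Tz; apply: additive_homog_eq0 => [z z'|r c Pr]; first by rewrite !distr; zmod.
rewrite !(tensM, br_tens) sign_tens (mulrCA b a c) mulrA -tensDl.
by rewrite -(poisson_leibnizr poissonP Pp Pq Pr) subrr.
Qed.

Lemma tensor_jacobi i j k x y z : Tg i x -> Tg j y -> Tg k z ->
  br x (br y z) - br (br x y) z - (-1) ^+ (i && j) * br y (br x z) = 0.
Proof.
move=> Tx Ty Tz.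
move: x Tx; apply: additive_homog_eq0 => [x x'|p a Pp]; first by rewrite !distr; zmod.
move: y Ty; apply: additive_homog_eq0 => [y y'|q b Pq]; first by rewrite !distr; zmod.
move: z Tz; apply: additive_homog_eq0 => [z z'|r c Pr]; first by rewrite !distr; zmod.
rewrite !br_tens sign_tens (mulrCA b a c) mulrA -!tensNl -!tensDl.
by rewrite (bracket_jacobi poissonP.2 Pp Pq Pr) !(mul0r, mulr0) !addr0 tens0l.
Qed.

(* In characteristic 3 this does not follow from the Jacobi identity, but the *)
(* latter makes x |-> {{x, x}, x} additive.                                   *)
Lemma tensor_odd_cube x : Tg true x -> br (br x x) x = 0.
Proof.
(* The induction carries the parity along, since the cross terms of a sum require it. *)
move=> Tx; suff [] : Tg true x /\ br (br x x) x = 0 by [].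
move: x Tx; apply: tensor_grading_ind.
- split; first exact: (tensor_grading_subspace A superP true).1.
  by rewrite (lin0 ((tensor_bracket_bilinear A (db_bilinear dbP)).2 _)).
- move=> x y [Tx x0] [Ty y0]; split; first exact: tensor_gradingD.
  (* This is the part of the cube of u + v of degree two in u and one in v; it vanishes by the
     Jacobi identity for (u, u, v). *)
  have cross u v : Tg true u -> Tg true v ->
      br (br u u) v + (br (br u v) u + br (br u v) u) = 0.
    move=> Tu Tv; have := tensor_jacobi Tu Tu Tv.
    rewrite (tensor_bracket_skew Tu (tensor_bracket_even Tu Tv)) /=.
    rewrite expr0 expr1 mul1r mulN1r opprK => uv.
    by rewrite -[RHS]oppr0 -uv; zmod.
  have yx : br y x = br x y.
    by rewrite (tensor_bracket_skew Ty Tx) /= expr1 mulN1r opprK.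
  have := congr2 +%R (cross x y Tx Ty) (cross y x Ty Tx).
  rewrite addr0 !yx => <-; rewrite !distr x0 y0 !yx; zmod.
- move=> p a Pp; split; first exact: tensor_grading_tens.
  by rewrite !br_tens (bracket_odd_cube poissonP.2 Pp) mulr0 oppr0 tens0l.
Qed.

Lemma tensor_poisson : is_poisson_superalgebra Tg br.
Proof.
split; split.
- exact: tensor_superalgebra superP.
- exact: tensor_supercommutative.
- exact: tensor_bracket_bilinear (db_bilinear dbP).
- exact: tensor_bracket_even.
- exact: tensor_bracket_skew.
- by move=> *; rewrite !mul0r subr0; apply: tensor_leibniz; eassumption.
- by move=> *; rewrite !(mul0r, mulr0) !addr0; apply: tensor_jacobi; eassumption.
- by move=> x Tx; rewrite mulr0 oppr0; apply: tensor_odd_cube.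
Qed.

End TensorPoisson.

(** * Extension of [E] and [D] to the tensor product, and conclusion *)

Theorem theorem6p1 (F : fieldType) (charF : 2%N \notin [pchar F])
  (P : algType F) (Pg : bool -> P -> Prop) (Pbr : P -> P -> P)
  (poissonP : is_poisson_superalgebra Pg Pbr)
  (E : P -> P) (derE : is_generalized_derivation E)
  (parE : parity_preserving Pg E)
  (brE : forall p q : P,
     E (Pbr p q) = Pbr (E p) q + Pbr p (E q) + Pbr p q * E 1)
  (A : comAlgType F)
  (D : A -> A) (derD : is_derivation D) :
  exists br : tensor P A -> tensor P A -> tensor P A,
    [/\ is_tensor_bracket Pg Pbr E D br,
        (forall br', is_tensor_bracket Pg Pbr E D br' -> br' =2 br)
      & is_jordan_bracket (tensor_grading Pg) br].
Proof.
have dbP := poissonP.1; have superP := db_superalgebra dbP.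
have poissonT := @tensor_poisson F P A Pg Pbr poissonP.
have superT := db_superalgebra poissonT.1.
have brTDl := @tensor_bracketDl F P A Pbr (db_bilinear dbP).
have brTDr := @tensor_bracketDr F P A Pbr (db_bilinear dbP).
have br_tens := @tensor_bracket_tens F P A Pbr (db_bilinear dbP).
have idPl : linear (@id P) by [].
have idAl : linear (@id A) by [].
have ET_lin := tensor_map_linear derE.1 idAl.
have DT_lin := tensor_map_linear idPl derD.1.
have ET_tens := tensor_map_tens derE.1 idAl.
have DT_tens := tensor_map_tens idPl derD.1.
set ET := tensor_map E id in ET_lin ET_tens.
set DT := tensor_map id D in DT_lin DT_tens.
have ET1 : ET 1 = E 1 ⊗ 1 by rewrite -ET_tens.
have ETD := linD ET_lin; have DTD := linD DT_lin.
have map_tens := (ET_tens, DT_tens, br_tens, @tensM F P A).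
have distr := (brTDl, brTDr, ETD, DTD, @mulrDl (tensor P A),
               @mulrDr (tensor P A), @opprD (tensor P A)).
(* The conditions that [twisted_jordan] puts on [ET] and [DT] are additive in each argument; on pure
   tensors they reduce to those on [E] and [D]. *)
have derET : is_generalized_derivation ET.
  split=> // x y; apply/eqP; rewrite -subr_eq0; apply/eqP; move: x.
  apply: additive_tensor_eq0 => [x x'|p a]; first by rewrite !distr; zmod.
  move: y; apply: additive_tensor_eq0 => [y y'|q b]; first by rewrite !distr; zmod.
  by rewrite ET1 !map_tens mulr1 derE.2 !tensDl tensNl subrr.
have derDT : is_derivation DT.
  split=> // x y; apply/eqP; rewrite -subr_eq0; apply/eqP; move: x.
  apply: additive_tensor_eq0 => [x x'|p a]; first by rewrite !distr; zmod.
  move: y; apply: additive_tensor_eq0 => [y y'|q b]; first by rewrite !distr; zmod.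
  by rewrite !map_tens derD.2 tensDr subrr.
have brET x y :
    ET (tensor_bracket Pbr x y) = tensor_bracket Pbr (ET x) y
      + tensor_bracket Pbr x (ET y) + tensor_bracket Pbr x y * ET 1.
  apply/eqP; rewrite -subr_eq0; apply/eqP; move: x.
  apply: additive_tensor_eq0 => [x x'|p a]; first by rewrite !distr; zmod.
  move: y; apply: additive_tensor_eq0 => [y y'|q b]; first by rewrite !distr; zmod.
  by rewrite ET1 !map_tens mulr1 brE !tensDl subrr.
have brDT x y :
    DT (tensor_bracket Pbr x y) = tensor_bracket Pbr (DT x) y
      + tensor_bracket Pbr x (DT y).
  apply/eqP; rewrite -subr_eq0; apply/eqP; move: x.
  apply: additive_tensor_eq0 => [x x'|p a]; first by rewrite !distr; zmod.
  move: y; apply: additive_tensor_eq0 => [y y'|q b]; first by rewrite !distr; zmod.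
  by rewrite !map_tens derD.2 tensDr subrr.
have DET x : DT (ET x) = ET (DT x).
  apply/eqP; rewrite -subr_eq0; apply/eqP; move: x.
  apply: additive_tensor_eq0 => [x x'|p a]; first by rewrite !distr; zmod.
  by rewrite !map_tens subrr.
have parET : parity_preserving (tensor_grading Pg) ET.
  move=> i; apply: tensor_grading_ind => [|x y|p a Pp].
  - by rewrite (lin0 ET_lin); apply: homog0 superT i.
  - by rewrite ETD; apply: homogD superT i _ _.
  - by rewrite ET_tens; apply/tensor_grading_tens/parE.
have parDT : parity_preserving (tensor_grading Pg) DT.
  move=> i; apply: tensor_grading_ind => [|x y|p a Pp].
  - by rewrite (lin0 DT_lin); apply: homog0 superT i.
  - by rewrite DTD; apply: homogD superT i _ _.
  - by rewrite DT_tens; apply: tensor_grading_tens.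
have brB : is_tensor_bracket Pg Pbr E D (twisted_bracket (tensor_bracket Pbr) ET DT).
  split; first exact: twisted_bilinear poissonT _ derET _ derDT.
  move=> i j p q a b Pp Pq; rewrite /twisted_bracket !map_tens.
  (* Exchanging [p] and [E q] produces exactly the sign of the prescribed formula. *)
  rewrite (db_supercommutative dbP Pp (parE _ _ Pq)).
  by rewrite mulr_sign scaler_sign; case: (i && j); rewrite ?tensNl.
exists (twisted_bracket (tensor_bracket Pbr) ET DT); split=> //; last first.
  exact: twisted_jordan.
move=> br' [br'_bilin br'E]; case: brB => br_bilin brE'.
apply: (bilinear_homog_eq superP) br'_bilin br_bilin _ => i j p q a b Pp Pq.
by rewrite (br'E i j) // (brE' i j).
Qed.
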